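(* Let $H$ be a Hopf algebra over a field $\Bbbk$. Every right partial $H$-module coalgebra $(C,\leftharpoonup)$ has a globalization.
   Context: All objects are over a field $\Bbbk$; coalgebras are counital, with Sweedler notation $\Delta(c)=c_1\otimes c_2$. Right $H$-module coalgebra $(D,\blacktriangleleft)$: $D$ a coalgebra, $\blacktriangleleft\colon D\otimes H\to D$ linear with $d\blacktriangleleft 1_H=d$, $\Delta(d\blacktriangleleft h)=d_1\blacktriangleleft h_1\otimes d_2\blacktriangleleft h_2$, $(d\blacktriangleleft h)\blacktriangleleft g=d\blacktriangleleft hg$ for all $d\in D$, $g,h\in H$. Right partial $H$-module coalgebra $(C,\leftharpoonup)$: $C$ a coalgebra, $\leftharpoonup\colon C\otimes H\to C$ linear with $c\leftharpoonup 1_H=c$, $\Delta(c\leftharpoonup h)=c_1\leftharpoonup h_1\otimes c_2\leftharpoonup h_2$, $(c\leftharpoonup h)\leftharpoonup g=\varepsilon(c_1\leftharpoonup h_1)(c_2\leftharpoonup h_2g)$ for all $c\in C$, $g,h\in H$. A globalization of a right partial $H$-module coalgebra $C$ is a triple $(D,\theta,\pi)$, where $D$ is a right $H$-module coalgebra via $\blacktriangleleft$, $\theta\colon C\to D$ is a coalgebra monomorphism (injective coalgebra map) and $\pi$ is a comultiplicative projection from $D$ onto $\theta(C)$ (a linear map with $\pi\circ\pi=\pi$, image $\theta(C)$, and $\Delta\circ\pi=(\pi\otimes\pi)\circ\Delta$), such that for all $h\in H,c\in C,d\in D$: (1) $\pi[\pi(d)\blacktriangleleft h]=\pi[\varepsilon(\pi(d_1))d_2\blacktriangleleft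 h]$; (2) $\theta(c\leftharpoonup h)=\pi(\theta(c)\blacktriangleleft h)$; (3) $D=\theta(C)\blacktriangleleft H$, the linear span of the elements $\theta(c)\blacktriangleleft h$. *)

(* Defs.v *)
From HB Require Import structures.
From mathcomp Require Import all_boot all_algebra.
From mathcomp Require Import boolp freeg.

Set Implicit Arguments.
Unset Strict Implicit.
Unset Printing Implicit Defensive.

Import GRing.Theory.
Local Open Scope ring_scope.
Local Open Scope quotient_scope.

Reserved Notation "u ⊗ v" (at level 40, left associativity).
Reserved Notation "U ⊗[ K ] V"
  (at level 40, K at level 200, left associativity, format "U  ⊗[ K ]  V").
Reserved Notation "\tsum_ ( u ⊗ v <- t ) F"
  (at level 41, F at level 41, u name, v name, t at level 200,
   format "\tsum_ ( u  ⊗  v  <-  t )  F").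

(* The tensor product of two vector spaces, of arbitrary dimension: the free
   vector space on U * V modulo the subspace spanned by the relations of
   bilinearity. *)
Section Tensor.
Variables (K : fieldType) (U V : lmodType K).

Inductive tensor_rel : {freeg (U * V) / K} -> Prop :=
| TensorRelL a u u' v :
    tensor_rel (<<(a *: u + u', v)>> - (a *: <<(u, v)>> + <<(u', v)>>))
| TensorRelR a u v v' :
    tensor_rel (<<(u, a *: v + v')>> - (a *: <<(u, v)>> + <<(u, v')>>))
| TensorRel0 : tensor_rel 0
| TensorRelP a x y : tensor_rel x -> tensor_rel y -> tensor_rel (a *: x + y).

Definition tensor_null : {pred {freeg (U * V) / K}} := fun x => `[< tensor_rel x >].

Fact tensor_null_zmod_closed : zmod_closed tensor_null.
Proof.
split=> [|x y /asboolP nx /asboolP ny]; apply/asboolP; first exact: TensorRel0.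
by rewrite addrC -scaleN1r; apply: TensorRelP.
Qed.

HB.instance Definition _ :=
  GRing.isZmodClosed.Build {freeg (U * V) / K} tensor_null tensor_null_zmod_closed.

Definition tensor : Type := Quotient.quot tensor_null.

HB.instance Definition _ := EqQuotient.on tensor.
HB.instance Definition _ := GRing.Zmodule.on tensor.

Definition tensor_pi (x : {freeg (U * V) / K}) : tensor := \pi_tensor x.

Fact tensor_piD x y : tensor_pi (x + y) = tensor_pi x + tensor_pi y.
Proof. exact: Quotient.pi_add. Qed.

Fact tensor_pi_eq x y : (tensor_pi x = tensor_pi y) <-> tensor_rel (x - y).
Proof.
rewrite /tensor_pi; split=> [/eqP|r]; last first.
  by apply/eqP; rewrite -Quotient.idealrBE; apply/asboolP.
by rewrite -Quotient.idealrBE => /asboolP.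
Qed.

Fact tensor_piK t : tensor_pi (repr t) = t.
Proof. exact: reprK. Qed.

Definition tensor_scale (a : K) (t : tensor) : tensor :=
  tensor_pi (a *: repr t).

Fact tensor_piZ a x : tensor_scale a (tensor_pi x) = tensor_pi (a *: x).
Proof.
apply/tensor_pi_eq; rewrite -scalerBr -[_ *: _]addr0.
apply: TensorRelP; last exact: TensorRel0.
by apply/tensor_pi_eq; rewrite tensor_piK.
Qed.

Fact tensor_scaleA a b t :
  tensor_scale a (tensor_scale b t) = tensor_scale (a * b) t.
Proof. by rewrite -[t]tensor_piK !tensor_piZ scalerA. Qed.

Fact tensor_scale1 : left_id 1 tensor_scale.
Proof. by move=> t; rewrite -[t]tensor_piK tensor_piZ scale1r. Qed.

Fact tensor_scaleDr : right_distributive tensor_scale +%R.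
Proof.
move=> a t t'; rewrite -[t]tensor_piK -[t']tensor_piK -tensor_piD.
by rewrite !tensor_piZ scalerDr tensor_piD.
Qed.

Fact tensor_scaleDl t : {morph tensor_scale^~ t : a b / a + b}.
Proof.
by move=> a b; rewrite -[t]tensor_piK !tensor_piZ scalerDl tensor_piD.
Qed.

HB.instance Definition _ := GRing.Zmodule_isLmodule.Build K tensor
  tensor_scaleA tensor_scale1 tensor_scaleDr tensor_scaleDl.

Fact tensor_pi_linear : linear tensor_pi.
Proof. by move=> a x y; rewrite tensor_piD -tensor_piZ. Qed.

HB.instance Definition _ :=
  GRing.isLinear.Build K {freeg (U * V) / K} tensor _ tensor_pi tensor_pi_linear.

Definition tens (u : U) (v : V) : tensor := tensor_pi <<(u, v)>>.

Lemma tens_is_bilinear : bilinear_for *:%R *:%R tens.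
Proof.
split=> [v a u u'|u a v v']; rewrite /tens -linearP;
  apply/tensor_pi_eq; [exact: TensorRelL | exact: TensorRelR].
Qed.

HB.instance Definition _ :=
  bilinear_isBilinear.Build K U V tensor *:%R *:%R tens tens_is_bilinear.

Lemma tensor_ind (P : tensor -> Prop) :
    P 0 -> (forall a u v t, P t -> P (a *: tens u v + t)) ->
  forall t, P t.
Proof.
move=> P0 PS t; rewrite -[t]tensor_piK; elim/freeg_ind_dom0: (repr t).
  by rewrite linear0.
move=> a [u v] x _ _ Px; rewrite linearD; have -> : << a *g (u, v) >> = a *: << (u, v) >>.
  by apply/eqP/freeg_eqP => z; rewrite coeffZ !coeffU mul1r.
by rewrite linearZ; apply: PS.
Qed.

End Tensor.

Notation "U ⊗[ K ] V" := (@tensor K U V) : type_scope.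
Notation "u ⊗ v" := (tens u v) : ring_scope.

(* [\tsum_(u ⊗ v <- t) f u v] is the image of [t] under the linear map induced
   by the bilinear map [f]. It is computed on a chosen representative of [t] as
   a formal sum; this choice is irrelevant when [f] is bilinear, which is the
   only case of interest (see [tsum_linear] and [tsum_tens]). Applied to a
   comultiplication, it is Sweedler's notation. *)
Definition tsum (K : fieldType) (U V W : lmodType K) (f : U -> V -> W)
    (t : U ⊗[K] V) : W :=
  fglift (fun uv => f uv.1 uv.2) (repr t).

Arguments tsum : simpl never.

Notation "\tsum_ ( u ⊗ v <- t ) F" := (tsum (fun u v => F) t) : ring_scope.

Section TsumTheory.
Variables (K : fieldType) (U V W : lmodType K) (f : U -> V -> W).
Hypothesis f_bilinear : bilinear_for *:%R *:%R f.

Let f1 (uv : U * V) := f uv.1 uv.2.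

Fact fglift_linear : linear (fglift f1).
Proof.
have add := lift_is_additive f1.
pose g : {additive _ -> _} := HB.pack (fglift f1) (GRing.isZmodMorphism.Build _ _ _ add).
move=> a x y; rewrite -[fglift f1]/(g : _ -> _) raddfD; congr (_ + _).
elim/freeg_ind_dom0: x => [|b z x _ _ IH]; first by rewrite !raddf0.
have -> : a *: (<< b *g z >> + x) = << a * b *g z >> + a *: x.
  by apply/eqP/freeg_eqP => z'; rewrite !(coeffZ, coeffD, coeffU) mulrDr mulrA.
by rewrite !raddfD IH /g /= !liftU scalerA.
Qed.

Fact fglift_null x : tensor_rel x -> fglift f1 x = 0.
Proof.
have lin := fglift_linear.
pose g : {linear _ -> _} := HB.pack (fglift f1) (GRing.isLinear.Build _ _ _ _ _ lin).
rewrite -[fglift f1]/(g : _ -> _); elim=> {x} [a u u' v|a u v v'||a x y _ gx _ gy].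
- by rewrite linearB linearP /g /= !liftU !scale1r /f1 /= (f_bilinear.1 v) subrr.
- by rewrite linearB linearP /g /= !liftU !scale1r /f1 /= (f_bilinear.2 u) subrr.
- exact: linear0.
- by rewrite linearP gx gy scaler0 addr0.
Qed.

Fact tsum_pi x : tsum f (tensor_pi x) = fglift f1 x.
Proof.
have lin := fglift_linear.
pose g : {linear _ -> _} := HB.pack (fglift f1) (GRing.isLinear.Build _ _ _ _ _ lin).
apply/eqP; rewrite -subr_eq0 /tsum -/f1 -[fglift f1]/(g : _ -> _) -linearB.
by apply/eqP/fglift_null/tensor_pi_eq; rewrite tensor_piK.
Qed.

Lemma tsum_linear : linear (tsum f).
Proof.
by move=> a t t'; rewrite -[t]tensor_piK -[t']tensor_piK -linearP !tsum_pi fglift_linear.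
Qed.

Lemma tsum_tens u v : \tsum_(x ⊗ y <- u ⊗ v) f x y = f u v.
Proof. by rewrite [LHS]tsum_pi liftU scale1r. Qed.

End TsumTheory.

HB.mixin Record Lmodule_isCoalgebra (K : fieldType) C of GRing.Lmodule K C := {
  Delta : {linear C -> C ⊗[K] C};
  eps : {scalar C};
  coassoc : forall c : C,
    \tsum_(a ⊗ b <- Delta c) \tsum_(a1 ⊗ a2 <- Delta a) (a1 ⊗ (a2 ⊗ b)) =
    \tsum_(a ⊗ b <- Delta c) \tsum_(b1 ⊗ b2 <- Delta b) (a ⊗ (b1 ⊗ b2));
  counitl : forall c : C, \tsum_(c1 ⊗ c2 <- Delta c) (eps c1 *: c2) = c;
  counitr : forall c : C, \tsum_(c1 ⊗ c2 <- Delta c) (eps c2 *: c1) = c;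
}.

#[short(type="coalgType")]
HB.structure Definition Coalgebra (K : fieldType) :=
  {C of GRing.Lmodule K C & Lmodule_isCoalgebra K C}.

HB.mixin Record Algebra_Coalgebra_isBialgebra (K : fieldType) H
    of GRing.Algebra K H & Coalgebra K H := {
  DeltaM : forall g h : H, Delta (g * h) =
    \tsum_(g1 ⊗ g2 <- Delta g) \tsum_(h1 ⊗ h2 <- Delta h) ((g1 * h1) ⊗ (g2 * h2));
  Delta1 : Delta (1 : H) = 1 ⊗ 1;
  epsM : forall g h : H, eps (g * h) = eps g * eps h;
  eps1 : eps (1 : H) = 1;
}.

#[short(type="bialgType")]
HB.structure Definition Bialgebra (K : fieldType) :=
  {H of GRing.Algebra K H & Coalgebra K H & Algebra_Coalgebra_isBialgebra K H}.

HB.mixin Record Bialgebra_isHopf (K : fieldType) H of Bialgebra K H := {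
  antipode : {linear H -> H};
  antipodel : forall h : H,
    \tsum_(h1 ⊗ h2 <- Delta h) (antipode h1 * h2) = (eps h)%:A;
  antipoder : forall h : H,
    \tsum_(h1 ⊗ h2 <- Delta h) (h1 * antipode h2) = (eps h)%:A;
}.

#[short(type="hopfType")]
HB.structure Definition Hopf (K : fieldType) :=
  {H of Bialgebra K H & Bialgebra_isHopf K H}.

Section Actions.
Variables (K : fieldType) (H : hopfType K).

Record is_module_coalgebra (D : coalgType K) (act : {linear D ⊗[K] H -> D}) : Prop := {
  mcoalg_act1 : forall d, act (d ⊗ 1) = d;
  mcoalg_Delta : forall d h, Delta (act (d ⊗ h)) =
    \tsum_(d1 ⊗ d2 <- Delta d) \tsum_(h1 ⊗ h2 <- Delta h)
      (act (d1 ⊗ h1) ⊗ act (d2 ⊗ h2));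
  mcoalg_actM : forall d h g, act (act (d ⊗ h) ⊗ g) = act (d ⊗ (h * g));
}.

Record is_partial_module_coalgebra (C : coalgType K) (pact : {linear C ⊗[K] H -> C}) :
    Prop := {
  pmcoalg_act1 : forall c, pact (c ⊗ 1) = c;
  pmcoalg_Delta : forall c h, Delta (pact (c ⊗ h)) =
    \tsum_(c1 ⊗ c2 <- Delta c) \tsum_(h1 ⊗ h2 <- Delta h)
      (pact (c1 ⊗ h1) ⊗ pact (c2 ⊗ h2));
  pmcoalg_actM : forall c h g, pact (pact (c ⊗ h) ⊗ g) =
    \tsum_(c1 ⊗ c2 <- Delta c) \tsum_(h1 ⊗ h2 <- Delta h)
      (eps (pact (c1 ⊗ h1)) *: pact (c2 ⊗ (h2 * g)));
}.

End Actions.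

Record is_coalgebra_map (K : fieldType) (C D : coalgType K) (f : {linear C -> D}) :
    Prop := {
  coalg_map_Delta : forall c,
    Delta (f c) = \tsum_(c1 ⊗ c2 <- Delta c) (f c1 ⊗ f c2);
  coalg_map_eps : forall c, eps (f c) = eps c;
}.

(* [p] is a projection of [D] onto the range of [f]; it is compatible with the
   comultiplication but not required to preserve the counit. *)
Record is_comult_projection (K : fieldType) (C D : coalgType K)
    (f : {linear C -> D}) (p : {linear D -> D}) : Prop := {
  comult_proj_idem : forall d, p (p d) = p d;
  comult_proj_range : forall x, (exists d, p d = x) <-> (exists c, f c = x);
  comult_proj_Delta : forall d,
    Delta (p d) = \tsum_(d1 ⊗ d2 <- Delta d) (p d1 ⊗ p d2);
}.

Definition in_span (K : fieldType) (V : lmodType K) (S : V -> Prop) (v : V) : Prop :=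
  exists (n : nat) (a : 'I_n -> K) (w : 'I_n -> V),
    (forall i, S (w i)) /\ v = \sum_i a i *: w i.

Record is_globalization (K : fieldType) (H : hopfType K)
    (C : coalgType K) (pact : {linear C ⊗[K] H -> C})
    (D : coalgType K) (act : {linear D ⊗[K] H -> D})
    (theta : {linear C -> D}) (proj : {linear D -> D}) : Prop := {
  glob_module : is_module_coalgebra act;
  glob_theta : is_coalgebra_map theta;
  glob_theta_inj : injective theta;
  glob_proj : is_comult_projection theta proj;
  glob_proj_act : forall d h, proj (act (proj d ⊗ h)) =
    proj (act ((\tsum_(d1 ⊗ d2 <- Delta d) (eps (proj d1) *: d2)) ⊗ h));
  glob_pact : forall c h, theta (pact (c ⊗ h)) = proj (act (theta c ⊗ h));
  glob_span : forall d : D,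
    in_span (fun x => exists c h, x = act (theta c ⊗ h)) d;
}.

(* Main.v *)
Require Import Defs.
From HB Require Import structures.
From mathcomp Require Import all_boot all_algebra.
From mathcomp Require Import freeg.

Set Implicit Arguments.
Unset Strict Implicit.
Unset Printing Implicit Defensive.

Import GRing.Theory.
Local Open Scope ring_scope.

(** The globalization is the tensor product coalgebra [D = C ⊗ H], on which [H]
    acts by [(c ⊗ h) ◂ g = c ⊗ hg], with [theta c = c ⊗ 1] and
    [pi (c ⊗ h) = (c ↼ h) ⊗ 1].

    This is a module coalgebra because the comultiplication of [H] is
    multiplicative, and [theta] is a coalgebra map because [1] is grouplike; it
    is split by [id ⊗ eps], hence injective. Since [c ⊗ h = theta c ◂ h], the
    image of [theta] generates [D], and [pi (theta c ◂ h) = theta (c ↼ h)].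
    The map [pi] is [theta] after the partial action, so it is comultiplicative
    because the partial action is, and idempotent because [c ↼ 1 = c]. Finally,
    for [d = c ⊗ h], the two sides of the condition on [pi (pi d ◂ g)] are the
    images under [theta] of the two sides of the partial associativity law
      [(c ↼ h) ↼ g = eps (c1 ↼ h1) (c2 ↼ h2 g)],
    so that condition carries exactly the axiom of a partial action.

    The work lies in the multilinear algebra. An identity between linear maps on
    a tensor product is checked on pure tensors ([tensor_linear_ext]), and
    Sweedler sums are handled as finite sums: they commute with linear maps
    ([apply_tsum]) and with each other ([exchange_tsum]). *)

(** * Linearity of composite expressions *)

Lemma linear_id (K : fieldType) (U : lmodType K) : linear (fun x : U => x).
Proof. by []. Qed.

Lemma linear_linearP (K : fieldType) (U V : lmodType K) (g : {linear U -> V}) :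
  linear g.
Proof. exact: linearP. Qed.

Lemma linear_compose (K : fieldType) (U V W : lmodType K) (g : V -> W) (f : U -> V) :
  linear g -> linear f -> linear (fun x => g (f x)).
Proof. by move=> lg lf a x y; rewrite lf lg. Qed.

Lemma linear_tensl (K : fieldType) (U V : lmodType K) (v : V) :
  linear (fun u : U => u ⊗ v).
Proof. exact: (@tens_is_bilinear K U V).1. Qed.

Lemma linear_tensr (K : fieldType) (U V : lmodType K) (u : U) :
  linear (fun v : V => u ⊗ v).
Proof. exact: (@tens_is_bilinear K U V).2. Qed.

Lemma linear_mull (K : fieldType) (A : algType K) (h : A) : linear (fun g => g * h).
Proof. by move=> a x y; rewrite mulrDl scalerAl. Qed.

Lemma linear_mulr (K : fieldType) (A : algType K) (g : A) : linear (fun h => g * h).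
Proof. by move=> a x y; rewrite mulrDr scalerAr. Qed.

Lemma linear_scalel (K : fieldType) (U V : lmodType K) (f : U -> K^o) (v : V) :
  linear f -> linear (fun x => f x *: v).
Proof. by move=> lf a x y; rewrite lf scalerDl scalerA. Qed.

Lemma linear_scaler (K : fieldType) (U V : lmodType K) (b : K) (f : U -> V) :
  linear f -> linear (fun x => b *: f x).
Proof. by move=> lf a x y; rewrite lf scalerDr !scalerA mulrC. Qed.

(** [eps] is linear for the multiplication of [K]; Sweedler sums take values in
    modules, so its codomain has to be read as the regular module [K^o]. *)
Lemma linear_eps (K : fieldType) (U : lmodType K) (C : coalgType K) (f : U -> C) :
  linear f -> linear (fun x => eps (f x) : K^o).
Proof. by move=> lf a x y; rewrite lf (linearP (eps : {scalar C})). Qed.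

Lemma bilinear_of_linear (K : fieldType) (U V W : lmodType K) (f : U -> V -> W) :
    (forall v, linear (f^~ v)) -> (forall u, linear (f u)) ->
  bilinear_for *:%R *:%R f.
Proof. by []. Qed.

(** * Sweedler sums as finite sums *)

Section FormalSum.
Variables (K : fieldType) (U V : lmodType K).

(** This holds for an arbitrary [f]: a Sweedler sum is the finite sum over the
    chosen representative. Hence the manipulations of sums below need no
    bilinearity, except when the tensor that is summed over varies. *)
Lemma tsumE (W : lmodType K) (f : U -> V -> W) (t : U ⊗[K] V) :
  \tsum_(u ⊗ v <- t) f u v =
  \sum_(z <- dom (repr t)) coeff z (repr t) *: f z.1 z.2.
Proof.
have add := lift_is_additive (fun uv : U * V => f uv.1 uv.2).
pose g : {additive _ -> _} := HB.pack (fglift _) (GRing.isZmodMorphism.Build _ _ _ add).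
rewrite /tsum -[fglift _]/(g : _ -> _) -{1}[repr t]freeg_sumE raddf_sum.
by apply: eq_bigr => z _; rewrite /g /= liftU.
Qed.

End FormalSum.

Section FormalSumTheory.
Variables (K : fieldType) (U V : lmodType K).

Lemma eq_tsum (W : lmodType K) (f g : U -> V -> W) (t : U ⊗[K] V) :
    (forall u v, f u v = g u v) ->
  \tsum_(u ⊗ v <- t) f u v = \tsum_(u ⊗ v <- t) g u v.
Proof. by move=> fg; rewrite !tsumE; apply: eq_bigr => z _; rewrite fg. Qed.

Lemma apply_tsum (W X : lmodType K) (g : W -> X) (f : U -> V -> W) (t : U ⊗[K] V) :
    linear g ->
  g (\tsum_(u ⊗ v <- t) f u v) = \tsum_(u ⊗ v <- t) g (f u v).
Proof.
move=> lin_g.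
pose h : {linear W -> X} := HB.pack g (GRing.isLinear.Build K W X *:%R g lin_g).
rewrite !tsumE -[g]/(h : _ -> _) linear_sum.
by apply: eq_bigr => z _; rewrite linearZ.
Qed.

Lemma exchange_tsum (U' V' W : lmodType K) (f : U -> V -> U' -> V' -> W)
    (t : U ⊗[K] V) (t' : U' ⊗[K] V') :
  \tsum_(u ⊗ v <- t) \tsum_(u' ⊗ v' <- t') f u v u' v' =
  \tsum_(u' ⊗ v' <- t') \tsum_(u ⊗ v <- t) f u v u' v'.
Proof.
rewrite tsumE [RHS]tsumE.
under eq_bigr => z _ do rewrite tsumE scaler_sumr.
under [RHS]eq_bigr => z' _ do rewrite tsumE scaler_sumr.
rewrite exchange_big; apply: eq_bigr => z' _; apply: eq_bigr => z _.
by rewrite !scalerA mulrC.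
Qed.

(** Linearity in a parameter of the summand, the tensor being fixed; linearity in
    the tensor is [tsum_linear]. *)
Lemma linear_tsum_body (X W : lmodType K) (f : X -> U -> V -> W) (t : U ⊗[K] V) :
    (forall u v, linear (fun x => f x u v)) ->
  linear (fun x => \tsum_(u ⊗ v <- t) f x u v).
Proof.
move=> lf a x y; rewrite !tsumE scaler_sumr -big_split /=.
by apply: eq_bigr => z _; rewrite lf scalerDr !scalerA mulrC.
Qed.

Lemma tensor_linear_ext (W : lmodType K) (f g : U ⊗[K] V -> W) :
    linear f -> linear g -> (forall u v, f (u ⊗ v) = g (u ⊗ v)) -> f =1 g.
Proof.
move=> lf lg fg; apply: tensor_ind => [|a u v t IH]; last by rewrite lf lg fg IH.
have lin0 (h : U ⊗[K] V -> W) : linear h -> h 0 = 0.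
  by move=> lh; have := lh (-1) 0 0; rewrite scaler0 addr0 scaleN1r addNr.
by rewrite !lin0.
Qed.

End FormalSumTheory.

(** Proves (multi)linearity of an expression by recursion on its syntax. The
    branches overlap when matching under the binder, and a branch where the
    variable occurs in a place supposed to be constant fails on application, so
    the choice has to backtrack. *)
Ltac linearity :=
  cbv beta;
  match goal with
  | |- bilinear_for _ _ _ => apply: bilinear_of_linear; linearity
  | |- forall x, _ => intro; linearity
  | |- linear (fun x => x) => exact: linear_id
  | |- linear (fun x => tsum (fun u v => @?F x u v) ?t) =>
      apply: (@linear_tsum_body _ _ _ _ _ F t); linearity
  | |- linear (fun x => tsum ?F (@?G x)) =>
      apply: (@linear_compose _ _ _ _ (tsum F) G); [apply: tsum_linear |]; linearity
  | |- linear (fun x => tens (@?F x) ?v) =>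
      apply: (@linear_compose _ _ _ _ (fun y => tens y v) F (linear_tensl v)); linearity
  | |- linear (fun x => tens ?u (@?F x)) =>
      apply: (@linear_compose _ _ _ _ (fun y => tens u y) F (linear_tensr u)); linearity
  | |- linear (fun x => GRing.scale (@?F x) ?v) =>
      apply: (@linear_scalel _ _ _ F); linearity
  | |- linear (fun x => GRing.scale ?a (@?F x)) =>
      apply: linear_scaler; linearity
  | |- linear (fun x => GRing.mul (@?F x) ?v) =>
      apply: (@linear_compose _ _ _ _ (fun y => GRing.mul y v) F (linear_mull v)); linearity
  | |- linear (fun x => GRing.mul ?a (@?F x)) =>
      apply: (@linear_compose _ _ _ _ (fun y => GRing.mul a y) F (linear_mulr a)); linearity
  | |- linear (fun x => GRing.Linear.sort (eps) (@?F x)) =>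
      apply: linear_eps; linearity
  | |- linear (fun x => GRing.Linear.sort ?g (@?F x)) =>
      apply: (@linear_compose _ _ _ _ g F (linear_linearP g)); linearity
  | |- linear _ =>
      first [exact: linear_linearP | exact: (linear_eps (@linear_id _ _)) | solve [auto]]
  end.

(** * The tensor product of two coalgebras *)

Section Trilinear.
Variables (K : fieldType) (C : coalgType K) (W : lmodType K) (f : C -> C -> C -> W).
Hypotheses (lin1 : forall y z, linear (fun x => f x y z))
  (lin2 : forall x z, linear (fun y => f x y z)) (lin3 : forall x y, linear (f x y)).

(** Sweedler's notation [f c1 c2 c3] is unambiguous: apply to coassociativity the
    linear map on [C ⊗ (C ⊗ C)] that a trilinear [f] induces. *)
Lemma coassoc_trilinear c :
  \tsum_(a ⊗ b <- Delta c) \tsum_(a1 ⊗ a2 <- Delta a) f a1 a2 b =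
  \tsum_(a ⊗ b <- Delta c) \tsum_(b1 ⊗ b2 <- Delta b) f a b1 b2.
Proof.
pose g (t : C ⊗[K] (C ⊗[K] C)) := \tsum_(x ⊗ t' <- t) \tsum_(y ⊗ z <- t') f x y z.
have bilin2 x : bilinear_for *:%R *:%R (f x) by linearity.
have bilin1 : bilinear_for *:%R *:%R (fun x t => \tsum_(y ⊗ z <- t) f x y z).
  by linearity.
have lin_g : linear g by exact: tsum_linear.
have g_tens x y z : g (x ⊗ (y ⊗ z)) = f x y z by rewrite /g !tsum_tens.
have := congr1 g (coassoc c); rewrite ![g _]apply_tsum //.
under eq_tsum => a b.
  rewrite apply_tsum //.
  under eq_tsum => a1 a2 do rewrite g_tens.
  over.
under [RHS]eq_tsum => a b.
  rewrite apply_tsum //.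
  under eq_tsum => a1 a2 do rewrite g_tens.
  over.
by [].
Qed.

End Trilinear.

Section TensorCoalgebra.
Variables (K : fieldType) (C E : coalgType K).

Definition tensor_Delta (t : C ⊗[K] E) : (C ⊗[K] E) ⊗[K] (C ⊗[K] E) :=
  \tsum_(c ⊗ e <- t) \tsum_(c1 ⊗ c2 <- Delta c) \tsum_(e1 ⊗ e2 <- Delta e)
    ((c1 ⊗ e1) ⊗ (c2 ⊗ e2)).

Definition tensor_eps (t : C ⊗[K] E) : K^o :=
  @tsum K C E K^o (fun c e => eps c *: (eps e : K^o)) t.

Lemma tensor_Delta_linear : linear tensor_Delta.
Proof. by rewrite /tensor_Delta; linearity. Qed.

Lemma tensor_eps_linear : linear tensor_eps.
Proof. by rewrite /tensor_eps; linearity. Qed.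

HB.instance Definition _ := GRing.isLinear.Build K (C ⊗[K] E) _ *:%R
  tensor_Delta tensor_Delta_linear.
HB.instance Definition _ := GRing.isLinear.Build K (C ⊗[K] E) K *%R
  tensor_eps tensor_eps_linear.

Lemma tensor_Delta_tens c e : tensor_Delta (c ⊗ e) =
  \tsum_(c1 ⊗ c2 <- Delta c) \tsum_(e1 ⊗ e2 <- Delta e) ((c1 ⊗ e1) ⊗ (c2 ⊗ e2)).
Proof. by rewrite /tensor_Delta tsum_tens; last linearity. Qed.

Lemma tensor_eps_tens c e : tensor_eps (c ⊗ e) = eps c * eps e.
Proof. by rewrite /tensor_eps tsum_tens; last linearity. Qed.

Lemma tsum_tensor_Delta (W : lmodType K) (f : C ⊗[K] E -> C ⊗[K] E -> W) c e :
    bilinear_for *:%R *:%R f ->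
  \tsum_(t1 ⊗ t2 <- tensor_Delta (c ⊗ e)) f t1 t2 =
  \tsum_(c1 ⊗ c2 <- Delta c) \tsum_(e1 ⊗ e2 <- Delta e) f (c1 ⊗ e1) (c2 ⊗ e2).
Proof.
move=> bil_f; have lin_f := tsum_linear bil_f.
rewrite tensor_Delta_tens (apply_tsum _ _ lin_f); apply: eq_tsum => c1 c2.
by rewrite (apply_tsum _ _ lin_f); apply: eq_tsum => e1 e2; rewrite tsum_tens.
Qed.

(** Regrouping the sums by factor, the ones over [C] and the ones over [E] are
    reassociated independently. *)
Lemma tensor_coassoc t :
  \tsum_(a ⊗ b <- tensor_Delta t) \tsum_(a1 ⊗ a2 <- tensor_Delta a) (a1 ⊗ (a2 ⊗ b)) =
  \tsum_(a ⊗ b <- tensor_Delta t) \tsum_(b1 ⊗ b2 <- tensor_Delta b) (a ⊗ (b1 ⊗ b2)).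
Proof.
move: t; apply: tensor_linear_ext => [||c e]; [linearity | linearity |].
rewrite !tsum_tensor_Delta; [|linearity|linearity].
pose T (x1 x2 x3 : C) (y1 y2 y3 : E) := (x1 ⊗ y1) ⊗ ((x2 ⊗ y2) ⊗ (x3 ⊗ y3)).
transitivity (\tsum_(c' ⊗ c3 <- Delta c) \tsum_(c1 ⊗ c2 <- Delta c')
    \tsum_(e' ⊗ e3 <- Delta e) \tsum_(e1 ⊗ e2 <- Delta e') T c1 c2 c3 e1 e2 e3).
  apply: eq_tsum => c' c3; rewrite [RHS]exchange_tsum; apply: eq_tsum => e' e3.
  by rewrite tsum_tensor_Delta //; linearity.
transitivity (\tsum_(c1 ⊗ c' <- Delta c) \tsum_(c2 ⊗ c3 <- Delta c')
    \tsum_(e1 ⊗ e' <- Delta e) \tsum_(e2 ⊗ e3 <- Delta e') T c1 c2 c3 e1 e2 e3).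
  rewrite coassoc_trilinear; [|rewrite /T; linearity..].
  apply: eq_tsum => c1 c'; apply: eq_tsum => c2 c3.
  by rewrite coassoc_trilinear //; rewrite /T; linearity.
apply: eq_tsum => c1 c'; rewrite exchange_tsum; apply: eq_tsum => e1 e'.
by rewrite tsum_tensor_Delta //; linearity.
Qed.

(** Expand [c ⊗ e] by the counit laws of both factors and pull the sums out. *)
Lemma tensor_counitl t : \tsum_(t1 ⊗ t2 <- tensor_Delta t) (tensor_eps t1 *: t2) = t.
Proof.
move: t; apply: tensor_linear_ext => [||c e]; [linearity | linearity |].
rewrite tsum_tensor_Delta; last by linearity.
rewrite -{2}[c]counitl (apply_tsum _ _ (linear_tensl e)); apply: eq_tsum => c1 c2.
rewrite -{2}[e]counitl (apply_tsum _ _ (linear_tensr _)); apply: eq_tsum => e1 e2.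
by rewrite tensor_eps_tens linearZl_LR linearZr_LR /= scalerA.
Qed.

Lemma tensor_counitr t : \tsum_(t1 ⊗ t2 <- tensor_Delta t) (tensor_eps t2 *: t1) = t.
Proof.
move: t; apply: tensor_linear_ext => [||c e]; [linearity | linearity |].
rewrite tsum_tensor_Delta; last by linearity.
rewrite -{2}[c]counitr (apply_tsum _ _ (linear_tensl e)); apply: eq_tsum => c1 c2.
rewrite -{2}[e]counitr (apply_tsum _ _ (linear_tensr _)); apply: eq_tsum => e1 e2.
by rewrite tensor_eps_tens linearZl_LR linearZr_LR /= scalerA.
Qed.

HB.instance Definition _ := Lmodule_isCoalgebra.Build K (C ⊗[K] E)
  tensor_coassoc tensor_counitl tensor_counitr.

End TensorCoalgebra.

Section TensorCoalgebraTheory.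
Variables (K : fieldType) (C E : coalgType K).

Lemma Delta_tens (c : C) (e : E) : Delta (c ⊗ e) =
  \tsum_(c1 ⊗ c2 <- Delta c) \tsum_(e1 ⊗ e2 <- Delta e) ((c1 ⊗ e1) ⊗ (c2 ⊗ e2)).
Proof. exact: tensor_Delta_tens. Qed.

Lemma eps_tens (c : C) (e : E) : eps (c ⊗ e) = eps c * eps e.
Proof. exact: tensor_eps_tens. Qed.

Lemma tsum_Delta_tens (W : lmodType K) (f : C ⊗[K] E -> C ⊗[K] E -> W) c e :
    bilinear_for *:%R *:%R f ->
  \tsum_(t1 ⊗ t2 <- Delta (c ⊗ e)) f t1 t2 =
  \tsum_(c1 ⊗ c2 <- Delta c) \tsum_(e1 ⊗ e2 <- Delta e) f (c1 ⊗ e1) (c2 ⊗ e2).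
Proof. exact: tsum_tensor_Delta. Qed.

End TensorCoalgebraTheory.

Lemma tsum_Delta1 (K : fieldType) (H : bialgType K) (W : lmodType K) (f : H -> H -> W) :
  bilinear_for *:%R *:%R f -> \tsum_(h1 ⊗ h2 <- Delta (1 : H)) f h1 h2 = f 1 1.
Proof. by move=> bil_f; rewrite Delta1 tsum_tens. Qed.

(** * The globalization [C ⊗ H] *)

Section Globalization.
Variables (K : fieldType) (H : hopfType K) (C : coalgType K).
Variables (pact : {linear C ⊗[K] H -> C}).

Definition ract_fun (t : (C ⊗[K] H) ⊗[K] H) : C ⊗[K] H :=
  \tsum_(d ⊗ g <- t) \tsum_(c ⊗ h <- d) (c ⊗ (h * g)).

Fact ract_fun_linear : linear ract_fun.
Proof. by rewrite /ract_fun; linearity. Qed.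

HB.instance Definition _ := GRing.isLinear.Build K _ _ *:%R ract_fun ract_fun_linear.

Definition ract : {linear (C ⊗[K] H) ⊗[K] H -> C ⊗[K] H} := ract_fun.

Lemma ract_tens c h g : ract ((c ⊗ h) ⊗ g) = c ⊗ (h * g).
Proof. by rewrite -[LHS]/(ract_fun _) /ract_fun !tsum_tens //; linearity. Qed.

(** Compatibility of the action with the comultiplication of [C ⊗ H] comes down to
    the multiplicativity of the comultiplication of [H]. *)
Lemma ract_module_coalgebra : is_module_coalgebra ract.
Proof.
split=> [d|d h|d h g].
- by move: d; apply: tensor_linear_ext => [||c k]; [linearity.. | rewrite ract_tens mulr1].
- move: d; apply: tensor_linear_ext => [||c k]; [linearity.. |].
  rewrite ract_tens tsum_Delta_tens; last by linearity.
  rewrite Delta_tens DeltaM; apply: eq_tsum => c1 c2.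
  have lin : linear (tsum (fun e1 e2 : H => (c1 ⊗ e1) ⊗ (c2 ⊗ e2))).
    by apply: tsum_linear; linearity.
  rewrite (apply_tsum _ _ lin); apply: eq_tsum => k1 k2.
  rewrite (apply_tsum _ _ lin); apply: eq_tsum => h1 h2.
  by rewrite tsum_tens ?ract_tens //; linearity.
move: d; apply: tensor_linear_ext => [||c k]; [linearity.. |].
by rewrite !ract_tens mulrA.
Qed.

Definition unit_embed_fun (c : C) : C ⊗[K] H := c ⊗ 1.

HB.instance Definition _ :=
  GRing.isLinear.Build K _ _ *:%R unit_embed_fun (linear_tensl (1 : H)).

Definition unit_embed : {linear C -> C ⊗[K] H} := unit_embed_fun.

Lemma unit_embedE c : unit_embed c = c ⊗ 1.
Proof. by []. Qed.

Lemma unit_embed_coalgebra_map : is_coalgebra_map unit_embed.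
Proof.
split=> c; last by rewrite unit_embedE eps_tens eps1 mulr1.
rewrite unit_embedE Delta_tens; apply: eq_tsum => c1 c2.
by rewrite tsum_Delta1 //; linearity.
Qed.

(** The left inverse is [id ⊗ eps], since [eps 1 = 1]. *)
Lemma unit_embed_inj : injective unit_embed.
Proof.
have bil : bilinear_for *:%R *:%R (fun (c : C) (h : H) => eps h *: c) by linearity.
apply: (can_inj (g := tsum (fun c h => eps h *: c))) => c.
by rewrite unit_embedE tsum_tens // eps1 scale1r.
Qed.

Definition unit_proj : {linear C ⊗[K] H -> C ⊗[K] H} := unit_embed \o pact.

Lemma unit_projE d : unit_proj d = unit_embed (pact d).
Proof. by []. Qed.

Hypothesis hpact : is_partial_module_coalgebra pact.

Lemma unit_proj_comult_projection : is_comult_projection unit_embed unit_proj.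
Proof.
have projK c : unit_proj (unit_embed c) = unit_embed c.
  by rewrite unit_projE unit_embedE (pmcoalg_act1 hpact).
split=> [d|x|d]; first by rewrite [unit_proj d]unit_projE projK.
  split=> [[d <-]|[c <-]]; first by exists (pact d).
  by exists (unit_embed c).
rewrite unit_projE (coalg_map_Delta unit_embed_coalgebra_map).
have bil : bilinear_for *:%R *:%R (fun a b => unit_embed a ⊗ unit_embed b) by linearity.
have lin := tsum_linear bil.
move: d; apply: tensor_linear_ext => [||c h]; [linearity.. |].
rewrite (pmcoalg_Delta hpact) tsum_Delta_tens; last by linearity.
rewrite (apply_tsum _ _ lin); apply: eq_tsum => c1 c2.
rewrite (apply_tsum _ _ lin); apply: eq_tsum => h1 h2.
by rewrite tsum_tens.
Qed.

(** On [c ⊗ h] both sides are images under [unit_embed] of the two sides of the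
    associativity law of the partial action. *)
Lemma unit_proj_ract d g : unit_proj (ract (unit_proj d ⊗ g)) =
  unit_proj (ract ((\tsum_(d1 ⊗ d2 <- Delta d) (eps (unit_proj d1) *: d2)) ⊗ g)).
Proof.
have eps_proj x : eps (unit_proj x) = eps (pact x).
  by rewrite unit_projE (coalg_map_eps unit_embed_coalgebra_map).
move: d; apply: tensor_linear_ext => [||c h]; [linearity.. |].
rewrite tsum_Delta_tens; last by linearity.
have lin : linear (fun d => unit_proj (ract (d ⊗ g))) by linearity.
have lin1 : linear unit_embed by linearity.
rewrite [RHS](apply_tsum _ _ lin).
rewrite [unit_proj (c ⊗ h)]unit_projE unit_embedE ract_tens mul1r unit_projE.
rewrite (pmcoalg_actM hpact) (apply_tsum _ _ lin1); apply: eq_tsum => c1 c2.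
rewrite (apply_tsum _ _ lin1) (apply_tsum _ _ lin); apply: eq_tsum => h1 h2.
by rewrite eps_proj linearZl_LR !linearZ /= ract_tens.
Qed.

(** A tensor is a sum of pure tensors, and [c ⊗ h = (c ⊗ 1) ◂ h]. *)
Lemma in_span_ract d :
  in_span (fun x => exists c h, x = ract (unit_embed c ⊗ h)) d.
Proof.
elim/tensor_ind: d => [|a c h t [n [b [w [wS ->]]]]].
  by exists 0%N, (fun=> 0), (fun=> 0); split; [case | rewrite big_ord0].
exists n.+1, (fun i => oapp b a (unlift ord0 i)),
  (fun i => oapp w (c ⊗ h) (unlift ord0 i)); split.
  move=> i; case: unliftP => [j _|_] /=; first exact: wS.
  by exists c, h; rewrite unit_embedE ract_tens mul1r.
rewrite big_ord_recl unlift_none /=; congr (_ + _).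
by apply: eq_bigr => i _; rewrite liftK.
Qed.

End Globalization.

Theorem theorem3p25 (K : fieldType) (H : hopfType K) (C : coalgType K)
    (pact : {linear C ⊗[K] H -> C}) (hpact : is_partial_module_coalgebra pact) :
  exists (D : coalgType K) (act : {linear D ⊗[K] H -> D})
         (theta : {linear C -> D}) (proj : {linear D -> D}),
    is_globalization pact act theta proj.
Proof.
exists (C ⊗[K] H), (@ract K H C), (@unit_embed K H C), (unit_proj pact); split.
- exact: ract_module_coalgebra.
- exact: unit_embed_coalgebra_map.
- exact: unit_embed_inj.
- exact: unit_proj_comult_projection.
- exact: unit_proj_ract.
- by move=> c h; rewrite unit_embedE ract_tens mul1r.
- exact: in_span_ract.
Qed.
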